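(* Let $n\ge1$ and $k\ge0$ be integers, and let $$P_k(z)=\sum_{\substack{\alpha,\beta\in\mathbb{N}_0^n\\|\alpha|+|\beta|=k}}a_{\alpha,\beta}\,z^\alpha\overline{z}^\beta,\qquad a_{\alpha,\beta}\in\mathbb{C},$$ be a complex $k$-homogeneous polynomial. Then $\mathcal{L}P_k=0$ if and only if $$\sum_{j=1}^n(\gamma_j+2)(\gamma_j+1)\,a_{\alpha,\gamma+2\varepsilon_j}=0\qquad\text{for all }\alpha,\gamma\in\mathbb{N}_0^n\text{ with }|\alpha|+|\gamma|=k-2,$$ where $\varepsilon_j=(0,\dots,0,1,0,\dots,0)$ is the unit multi-index with $1$ in position $j$.
   Context: Here $z_j=x_j+iy_j$, $\overline{z}_j=x_j-iy_j$ for $j=1,\dots,n$, with $(x,y)\in\mathbb{R}^n\times\mathbb{R}^n=\mathbb{R}^{2n}$; for a multi-index $\alpha\in\mathbb{N}_0^n$, $z^\alpha=z_1^{\alpha_1}\cdots z_n^{\alpha_n}$, $\overline{z}^\alpha=\overline{z}_1^{\alpha_1}\cdots\overline{z}_n^{\alpha_n}$ and $|\alpha|=\alpha_1+\cdots+\alpha_n$. The operator is $\mathcal{L}=\sum_{j=1}^n\partial_{z_j}^2$ with $\partial_{z_j}=\partial_{x_j}+i\partial_{y_j}$ (no factor $1/2$), so $\partial_{z_j}z_j=0$ and $\partial_{z_j}\overline{z}_j=2$. *)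

(* Defs.v *)
From mathcomp Require Import all_boot all_order all_algebra.
From mathcomp Require Import complex.
From mathcomp Require Import all_classical all_reals all_analysis.

Set Implicit Arguments.
Unset Strict Implicit.
Unset Printing Implicit Defensive.
Import Order.TTheory GRing.Theory Num.Theory.
Import numFieldNormedType.Exports.

Local Open Scope classical_set_scope.
Local Open Scope ring_scope.
Local Open Scope complex_scope.

(* Multi-indices carry the pointwise N-module structure of finite functions,
   so [gamma + eps j *+ 2] is the multi-index gamma + 2 eps_j. *)
Notation multiindex n := {ffun 'I_n -> nat}.

Definition mdeg n (alpha : multiindex n) : nat := (\sum_(j < n) alpha j)%N.

Definition eps n (j : 'I_n) : multiindex n := [ffun i => (i == j : nat)].

Definition bidegree n k : set (multiindex n * multiindex n) :=
  [set ab | (mdeg ab.1 + mdeg ab.2 = k)%N].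

(* [\sum_(i \in A) F i] is 0 by convention when F has infinite support in A;
   this lemma shows that the convention plays no role here. *)
Lemma finite_bidegree n k : finite_set (@bidegree n k).
Proof.
pose f (p : {ffun 'I_n -> 'I_k.+1} * {ffun 'I_n -> 'I_k.+1}) :
    multiindex n * multiindex n :=
  ([ffun i => p.1 i : nat], [ffun i => p.2 i : nat]).
apply: (@sub_finite_set _ _ (f @` setT)); last first.
  exact/finite_image/finite_finset.
have le_mdeg (c : multiindex n) i : (c i <= mdeg c)%N.
  by rewrite /mdeg (bigD1 i) //= leq_addr.
move=> [a b] /= abk.
exists ([ffun i => inord (a i)], [ffun i => inord (b i)]) => //.
congr pair; apply/ffunP => i; rewrite !ffunE inordK // ltnS -abk.
  exact: leq_trans (le_mdeg a i) (leq_addr _ _).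
exact: leq_trans (le_mdeg b i) (leq_addl _ _).
Qed.

(* R^n x R^n, with points w = (x, y). *)
Notation R2n R n := ('rV[R]_n * 'rV[R]_n)%type.

Section Operator.
Variables (R : realType) (n : nat).
Implicit Types (f : R2n R n -> R[i]) (w v : R2n R n) (j : 'I_n).

Definition zcoord j w : R[i] := w.1 ord0 j +i* w.2 ord0 j.

Definition zbarcoord j w : R[i] := w.1 ord0 j -i* w.2 ord0 j.

Definition zpow (alpha : multiindex n) w : R[i] :=
  \prod_(j < n) zcoord j w ^+ alpha j.

Definition zbarpow (alpha : multiindex n) w : R[i] :=
  \prod_(j < n) zbarcoord j w ^+ alpha j.

Definition hpoly (k : nat) (a : multiindex n -> multiindex n -> R[i]) w : R[i] :=
  \sum_(ab \in bidegree k) a ab.1 ab.2 * zpow ab.1 w * zbarpow ab.2 w.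

(* R[i] is not a normed module over R in the library, so the directional
   derivative of a complex-valued function is taken componentwise. *)
Definition cderive f v w : R[i] :=
  ('D_v (fun u => complex.Re (f u)) w) +i* ('D_v (fun u => complex.Im (f u)) w).

Definition dx j f w : R[i] := cderive f (delta_mx ord0 j, 0) w.

Definition dy j f w : R[i] := cderive f (0, delta_mx ord0 j) w.

(* [dz j zcoord_j = 0] and [dz j zbarcoord_j = 2]: this is twice the Wirtinger
   derivative with respect to zbar_j. *)
Definition dz j f w : R[i] := dx j f w + (0 +i* 1) * dy j f w.

Definition calL f w : R[i] := \sum_(j < n) dz j (dz j f) w.

End Operator.

(* Main.v *)
(** Write [z_j = zcoord j], [zbar_j = zbarcoord j].  The operator [dz j] is a
    derivation killing every [z_l] and sending [zbar_l] to [2] if [l = j] and to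
    [0] otherwise, so it maps the homogeneous polynomial of degree [k + 1] with
    coefficients [a alpha beta] to the one of degree [k] with coefficients
    [2 (gamma_j + 1) a alpha (gamma + eps_j)].  Applying this twice gives the
    coefficients of [calL (hpoly k a)].  It also gives, by induction on the
    degree, that a homogeneous polynomial function vanishes only if its
    coefficients do: [dz j] handles the monomials with [beta <> 0], and complex
    conjugation, which exchanges [alpha] and [beta], the other nonconstant
    ones. *)
Require Import Defs.
From mathcomp Require Import all_boot all_order all_algebra.
From mathcomp Require Import complex.
From mathcomp Require Import all_classical all_reals all_analysis.
From mathcomp Require Import ring finmap.

Import GRing.Theory.
Import numFieldNormedType.Exports.
Local Open Scope ring_scope.
Local Open Scope complex_scope.

(** For [h <> 0] the difference quotient is exactly [c], so the limit is that of a constant. *)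
Lemma is_derive_affine_line (R : realType) (V : normedModType R) (f : V -> R)
    (w v : V) (c : R) :
  (forall h : R, f (h *: v + w) = h * c + f w) -> is_derive w v f c.
Proof.
move=> fE.
have cv : ((fun h : R => h^-1 *: ((f \o shift w) (h *: v) - f w)) @
    0^' --> c)%classic.
  apply: cvg_near_cst; near=> h.
  rewrite /= fE addrK /GRing.scale /= mulKf //.
  by near: h; exact: nbhs_dnbhs_neq.
split; first by apply/cvg_ex; exists c.
exact: cvg_lim cv.
Unshelve. all: by end_near. Qed.

(** * Differentiation rules for [dz j] *)

Section ZDerivation.
Local Set Implicit Arguments.
Local Unset Strict Implicit.
Context {R : realType} {n : nat}.
Implicit Types (f g : R2n R n -> R[i]) (w v : R2n R n) (j l : 'I_n).

(** ['D_v] is total, so a value alone does not give differentiability. The sum and product rules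
    need both, hence a relation carrying existence and value. *)
Definition has_cderive w v f (d : R[i]) : Prop :=
  is_derive w v (fun u => complex.Re (f u)) (complex.Re d) /\
  is_derive w v (fun u => complex.Im (f u)) (complex.Im d).

Lemma has_cderive_val w v f d : has_cderive w v f d -> cderive f v w = d.
Proof. by case: d => p q [/= [_ fp] [_ fq]]; rewrite /cderive fp fq. Qed.

Lemma has_cderive_cst w v (c : R[i]) : has_cderive w v (fun=> c) 0.
Proof. by split; exact: is_derive_cst. Qed.

Lemma has_cderiveD w v f g df dg : has_cderive w v f df ->
  has_cderive w v g dg -> has_cderive w v (fun u => f u + g u) (df + dg).
Proof.
case: df dg => [p q] [r s] [/= fp fq] [/= gr gs]; split=> /=.
  rewrite (_ : (fun u => _) =
    (fun u => complex.Re (f u)) + (fun u => complex.Re (g u))).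
    exact: is_deriveD.
  by apply: funext => u /=; rewrite /GRing.add /=; case: (f u) (g u) => [??] [].
rewrite (_ : (fun u => _) =
  (fun u => complex.Im (f u)) + (fun u => complex.Im (g u))).
  exact: is_deriveD.
by apply: funext => u /=; rewrite /GRing.add /=; case: (f u) (g u) => [??] [].
Qed.

Lemma has_cderiveM w v f g df dg : has_cderive w v f df ->
  has_cderive w v g dg ->
  has_cderive w v (fun u => f u * g u) (f w * dg + df * g w).
Proof.
case=> fr fi [gr gi].
split.
  rewrite (_ : (fun u => _) =
    (fun u => complex.Re (f u)) * (fun u => complex.Re (g u))
    - (fun u => complex.Im (f u)) * (fun u => complex.Im (g u))); last first.
    by apply: funext => u; rewrite !fctE; case: (f u) (g u) => [??] [].
  refine (is_derive_eq (is_deriveB (is_deriveM fr gr) (is_deriveM fi gi)) _).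
  case: (f w) (g w) df dg {fr fi gr gi} => [a b] [c d] [p q] [r s] /=.
  by rewrite /GRing.scale /=; ring.
rewrite (_ : (fun u => _) =
  (fun u => complex.Re (f u)) * (fun u => complex.Im (g u))
  + (fun u => complex.Im (f u)) * (fun u => complex.Re (g u))); last first.
  by apply: funext => u; rewrite !fctE; case: (f u) (g u) => [??] [].
refine (is_derive_eq (is_deriveD (is_deriveM fr gi) (is_deriveM fi gr)) _).
case: (f w) (g w) df dg {fr fi gr gi} => [a b] [c d] [p q] [r s] /=.
by rewrite /GRing.scale /=; ring.
Qed.

(** A real-linear function is its own derivative at every point. *)
Lemma has_cderive_zcoord w v j : has_cderive w v (zcoord j) (zcoord j v).
Proof. by split; apply: is_derive_affine_line => h /=; rewrite !mxE. Qed.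

Lemma has_cderive_zbarcoord w v j :
  has_cderive w v (zbarcoord j) (zbarcoord j v).
Proof.
split; apply: is_derive_affine_line => h /=; rewrite !mxE //.
by rewrite opprD mulrN.
Qed.

Definition has_dz w j f (d : R[i]) : Prop :=
  exists p q, [/\ has_cderive w (delta_mx ord0 j, 0) f p,
    has_cderive w (0, delta_mx ord0 j) f q & d = p + 'i * q].

Lemma has_dz_val w j f d : has_dz w j f d -> dz j f w = d.
Proof.
case=> p [q [/has_cderive_val fp /has_cderive_val fq ->]].
by rewrite /dz /dx /dy fp fq.
Qed.

Lemma has_dz_cst w j (c : R[i]) : has_dz w j (fun=> c) 0.
Proof.
by exists 0, 0; split; [exact: has_cderive_cst..|rewrite mulr0 addr0].
Qed.

Lemma has_dzD w j f g df dg : has_dz w j f df -> has_dz w j g dg ->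
  has_dz w j (fun u => f u + g u) (df + dg).
Proof.
move=> [p [q [fp fq ->]]] [r [s [gr gs ->]]].
exists (p + r), (q + s); split; [exact: has_cderiveD..|].
by rewrite mulrDr addrACA.
Qed.

Lemma has_dzM w j f g df dg : has_dz w j f df -> has_dz w j g dg ->
  has_dz w j (fun u => f u * g u) (f w * dg + df * g w).
Proof.
move=> [p [q [fp fq ->]]] [r [s [gr gs ->]]].
exists (f w * r + p * g w), (f w * s + q * g w).
split; [exact: has_cderiveM..|].
by rewrite !mulrDr mulrDl addrACA mulrCA !mulrA.
Qed.

Lemma has_dz_zcoord w j l : has_dz w j (zcoord l) 0.
Proof.
eexists _, _; split; [exact: has_cderive_zcoord..|].
rewrite /zcoord /= !mxE /=.
(* For [l = j] the partial derivatives are [1] and ['i], and [1 + 'i * 'i = 0]. *)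
by case: eqP => _; simpc.
Qed.

Lemma has_dz_zbarcoord w j l : has_dz w j (zbarcoord l) (2 * (l == j))%:R.
Proof.
eexists _, _; split; [exact: has_cderive_zbarcoord..|].
rewrite /zbarcoord /= !mxE /=.
(* For [l = j] they are [1] and [- 'i], and [1 - 'i * 'i = 2]. *)
by case: eqP => _; simpc; rewrite // muln1 (natrD _ 1 1); simpc.
Qed.

Lemma has_dz_sum (I : Type) (r : seq I) w j (F : I -> R2n R n -> R[i])
    (dF : I -> R[i]) :
  (forall i, has_dz w j (F i) (dF i)) ->
  has_dz w j (fun u => \sum_(i <- r) F i u) (\sum_(i <- r) dF i).
Proof.
move=> FdF; elim: r => [|i r IH].
  rewrite big_nil (_ : (fun u => _) = fun=> 0); first exact: has_dz_cst.
  by apply: funext => u; rewrite big_nil.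
rewrite big_cons (_ : (fun u => _) = fun u => F i u + \sum_(i <- r) F i u).
  exact: has_dzD.
by apply: funext => u; rewrite big_cons.
Qed.

Lemma has_dzX w j f df m : has_dz w j f df ->
  has_dz w j (fun u => f u ^+ m) (m%:R * f w ^+ m.-1 * df).
Proof.
move=> fdf; elim: m => [|m IH]; first by rewrite !mul0r; exact: has_dz_cst.
rewrite (_ : (fun u => _) = fun u => f u * f u ^+ m); last first.
  by apply: funext => u; rewrite exprS.
have := has_dzM fdf IH; congr has_dz.
(* [f w * f w ^+ m.-1 = f w ^+ m] needs [m > 0]; at [m = 0] the term carries the factor [0]. *)
case: m {IH} => [|m] /=; first by rewrite !mul0r mulr0 mul1r add0r mulrC.
by rewrite (natrD _ 1 m.+1) exprS; ring.
Qed.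

(** By the product rule, the functions killed by the derivation are closed under products. This
    serves for [zpow] and for the factors of [zbarpow] other than the [j]-th. *)
Lemma has_dz_prod0 (I : Type) (r : seq I) (P : pred I) w j
    (F : I -> R2n R n -> R[i]) :
  (forall i, P i -> has_dz w j (F i) 0) ->
  has_dz w j (fun u => \prod_(i <- r | P i) F i u) 0.
Proof.
move=> F0; elim: r => [|i r IH].
  rewrite (_ : (fun u => _) = fun=> 1); first exact: has_dz_cst.
  by apply: funext => u; rewrite big_nil.
have [Pi|/negPf nPi] := boolP (P i); last first.
  rewrite (_ : (fun u => _) = fun u => \prod_(i <- r | P i) F i u) //.
  by apply: funext => u; rewrite big_cons nPi.
rewrite (_ : (fun u => _) = fun u => F i u * \prod_(i <- r | P i) F i u).
  by have := has_dzM (F0 _ Pi) IH; rewrite mulr0 mul0r addr0.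
by apply: funext => u; rewrite big_cons Pi.
Qed.

Lemma has_dz_zpow w j (alpha : multiindex n) : has_dz w j (zpow alpha) 0.
Proof.
apply: has_dz_prod0 => l _.
by have := has_dzX (alpha l) (has_dz_zcoord w j l); rewrite mulr0.
Qed.

(** Subtraction is truncated: this is [beta - eps j] if [0 < beta j], and [beta] otherwise. In the
    second case the coefficient [beta j] in [has_dz_zbarpow] is zero. *)
Definition mpred (beta : multiindex n) j : multiindex n :=
  [ffun i => (beta i - (i == j))%N].

Lemma has_dz_zbarpow w j (beta : multiindex n) :
  has_dz w j (zbarpow beta) ((2 * beta j)%:R * zbarpow (mpred beta j) w).
Proof.
rewrite (_ : zbarpow beta = fun u => zbarcoord j u ^+ beta j *
   \prod_(l < n | l != j) zbarcoord l u ^+ beta l); last first.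
  by apply: funext => u; rewrite /zbarpow (bigD1 j).
have P0 : has_dz w j
    (fun u => \prod_(l < n | l != j) zbarcoord l u ^+ beta l) 0.
  apply: has_dz_prod0 => l /negPf lj.
  by have := has_dzX (beta l) (has_dz_zbarcoord w j l); rewrite lj mulr0.
have := has_dzM (has_dzX (beta j) (has_dz_zbarcoord w j j)) P0.
rewrite mulr0 add0r eqxx muln1; congr has_dz.
rewrite /zbarpow [in RHS](bigD1 j) //= !ffunE eqxx subn1.
rewrite [in RHS](eq_bigr (fun l => zbarcoord l w ^+ beta l)).
  by rewrite natrM; ring.
by move=> l /negPf lj; rewrite ffunE lj subn0.
Qed.

End ZDerivation.

(** * Shifts of multi-indices by [eps j] *)

Section Multiindex.
Context {n : nat}.
Implicit Types (alpha beta gamma : multiindex n) (j : 'I_n).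

Lemma mdegD alpha beta : mdeg (alpha + beta) = (mdeg alpha + mdeg beta)%N.
Proof. by rewrite /mdeg -big_split; apply: eq_bigr => i _; rewrite ffunE. Qed.

Lemma mdeg_eps j : mdeg (eps j) = 1%N.
Proof.
rewrite /mdeg (bigD1 j) //= big1 => [|i /negPf ij]; rewrite ffunE ?eqxx //.
by rewrite ij.
Qed.

Lemma mdeg_eq0 alpha : (mdeg alpha == 0%N) = (alpha == 0).
Proof.
apply/eqP/eqP => [/eqP|->]; last first.
  by rewrite /mdeg big1 // => i _; rewrite ffunE.
rewrite sum_nat_eq0 => /forallP a0.
by apply/ffunP => i; rewrite ffunE; exact/eqP/a0.
Qed.

Lemma addepsE gamma j : (gamma + eps j) j = (gamma j).+1.
Proof. by rewrite !ffunE eqxx; exact: addn1. Qed.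

Lemma mpredD1 gamma j : mpred (gamma + eps j) j = gamma.
Proof. by apply/ffunP => i; rewrite !ffunE addnK. Qed.

Lemma mpredK beta j : (0 < beta j)%N -> mpred beta j + eps j = beta.
Proof.
move=> bj; apply/ffunP => i; rewrite !ffunE.
by apply: subnK; case: eqP => // ->.
Qed.

Lemma neq0_eps beta : beta != 0 -> exists j gamma, beta = gamma + eps j.
Proof.
move=> b0; have [j bj] : exists j, beta j != 0%N.
  apply/existsP; rewrite -negb_forall; apply: contra b0 => /forallP b0.
  by apply/eqP/ffunP => i; rewrite ffunE; exact/eqP/b0.
by exists j, (mpred beta j); rewrite mpredK // lt0n.
Qed.

Lemma bidegree0 : bidegree 0 = [set (0, 0)]%classic :> set (multiindex n * _).
Proof.
rewrite /bidegree; apply/seteqP; split=> [[al be]|_ ->] /=.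
  by move/eqP; rewrite addn_eq0 !mdeg_eq0 => /andP[/eqP -> /eqP ->].
by apply/eqP; rewrite addn_eq0 !mdeg_eq0 eqxx.
Qed.

(** The target indexes the monomials of degree [k + 1] that contain [zbar_j], the only ones with a
    nonzero image under [dz j]. *)
Lemma set_bij_bidegreeS k j : set_bij (bidegree k)
  [set ab | (mdeg ab.1 + mdeg ab.2 = k.+1)%N /\ (0 < ab.2 j)%N]%classic
  (fun ag : multiindex n * multiindex n => (ag.1, ag.2 + eps j)).
Proof.
split=> [[al ga] /= <-|[al ga] [al' ga'] _ _ /= [->]|].
- by rewrite mdegD mdeg_eps addnA addn1 addepsE.
- by move=> /(congr1 (mpred ^~ j)); rewrite !mpredD1 => ->.
move=> [al be] /= [abk bj]; exists (al, mpred be j); last by rewrite /= mpredK.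
by move: abk; rewrite -{1}(mpredK be j bj) mdegD mdeg_eps addnA addn1 => -[].
Qed.

End Multiindex.

(** * Homogeneous polynomials and their coefficients *)

Section Hpoly.
Context {R : realType} {n : nat}.
Implicit Types (k : nat) (c : multiindex n -> multiindex n -> R[i]).
Implicit Types (alpha beta gamma : multiindex n) (w : R2n R n) (j : 'I_n).

Lemma hpolyE k c w : hpoly k c w =
  \sum_(ab <- fset_set (@bidegree n k))
    c ab.1 ab.2 * zpow ab.1 w * zbarpow ab.2 w.
Proof. by rewrite /hpoly fsbig_finite //; exact: finite_bidegree. Qed.

Lemma dz_hpoly k c j w : dz j (hpoly k c) w =
  \sum_(ab \in bidegree k) c ab.1 ab.2 * zpow ab.1 w *
    ((2 * ab.2 j)%:R * zbarpow (mpred ab.2 j) w).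
Proof.
rewrite (funext (hpolyE k c)) fsbig_finite; last exact: finite_bidegree.
apply/has_dz_val/has_dz_sum => ab.
have := has_dzM (has_dzM (has_dz_cst w j (c ab.1 ab.2)) (has_dz_zpow w j ab.1))
  (has_dz_zbarpow w j ab.2).
by rewrite mulr0 !mul0r addr0 mul0r addr0.
Qed.

Lemma dz_hpoly0 c j : dz j (hpoly 0 c) = fun=> 0.
Proof.
apply: funext => w; rewrite dz_hpoly bidegree0 fsbig_set1 /= ffunE.
by rewrite muln0 mul0r mulr0.
Qed.

Lemma dz_hpolyS k c j : dz j (hpoly k.+1 c) =
  hpoly k (fun alpha gamma => (2 * (gamma j).+1)%:R * c alpha (gamma + eps j)).
Proof.
apply: funext => w; rewrite dz_hpoly.
pose D : set (multiindex n * multiindex n) :=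
  [set ab | (mdeg ab.1 + mdeg ab.2 = k.+1)%N /\ (0 < ab.2 j)%N]%classic.
(* Terms with [ab.2 j = 0] vanish, so the sum may be restricted to [D] and then reindexed by the
   shift. *)
rewrite -(fsbig_widen D); first last.
- move=> [al be] /= [abk]; rewrite /D /=.
  case: (posnP (be j)) => [-> _|bj []//].
  by rewrite muln0 mul0r mulr0.
- by move=> ab [].
rewrite (reindex_fsbig _ _ _ _ (set_bij_bidegreeS k j)).
apply: eq_fsbigr => -[al ga] _ /=.
by rewrite mpredD1 addepsE; ring.
Qed.

Lemma hpoly_sum (I : finType) k
    (c : I -> multiindex n -> multiindex n -> R[i]) w :
  \sum_i hpoly k (c i) w = hpoly k (fun al be => \sum_i c i al be) w.
Proof.
rewrite hpolyE (eq_bigr _ (fun i _ => hpolyE k (c i) w)) exchange_big.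
by apply: eq_bigr => ab _; rewrite !big_distrl.
Qed.

Lemma conjc_hpoly k c w :
  (hpoly k c w)^* = hpoly k (fun al be => (c be al)^*) w.
Proof.
have swap : set_bij (@bidegree n k) (@bidegree n k)
    (fun ab : multiindex n * multiindex n => (ab.2, ab.1)).
  split=> [[al be] /= <-|[a b] [a' b'] _ _ [-> ->] //|[al be] /= abk].
    by rewrite /bidegree /= addnC.
  by exists (be, al) => //=; rewrite /bidegree /= addnC.
have conj_zcoord j : (zcoord j w)^* = zbarcoord j w by [].
have conj_zbarcoord j : (zbarcoord j w)^* = zcoord j w.
  by rewrite -conj_zcoord conjcK.
rewrite [RHS]/hpoly (reindex_fsbig _ _ _ _ swap) hpolyE.
rewrite fsbig_finite; last exact: finite_bidegree.
rewrite rmorph_sum; apply: eq_bigr => -[al be] _ /=.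
rewrite !rmorphM /= /zpow /zbarpow !rmorph_prod /= mulrAC.
congr (_ * _ * _); apply: eq_bigr => j _.
  by rewrite rmorphXn -conj_zbarcoord.
by rewrite rmorphXn -conj_zcoord.
Qed.

Lemma hpoly_eq0P k c : (forall w, hpoly k c w = 0) <->
  (forall alpha beta, (mdeg alpha + mdeg beta = k)%N -> c alpha beta = 0).
Proof.
split; last first.
  move=> c0 w; apply: fsbig1 => -[al be] /= abk.
  by rewrite c0 // !mul0r.
elim: k c => [|k IH] c F0 al be abk.
  (* The only monomial of degree 0 is the constant [1], so evaluation at a point returns its
     coefficient. *)
  have := F0 0; rewrite /hpoly bidegree0 fsbig_set1 /= /zpow /zbarpow.
  move/eqP: abk; rewrite addn_eq0 !mdeg_eq0 => /andP[/eqP -> /eqP ->].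
  by rewrite !big1 ?mulr1 // => j _; rewrite ffunE.
(* Coefficients with nonzero second index: apply [dz j] and the induction hypothesis, then cancel
   the nonzero integer [2 * (gamma j).+1]. It is stated for all [c'] so as to apply also to the
   conjugate polynomial. *)
have step c' : (forall w, hpoly k.+1 c' w = 0) -> forall alpha gamma j,
    (mdeg alpha + mdeg (gamma + eps j)%R = k.+1)%N ->
    c' alpha (gamma + eps j) = 0.
  move=> {}F0 alpha gamma j; rewrite mdegD mdeg_eps addnA addn1 => -[agk].
  have dF0 w : hpoly k (fun alpha gamma =>
      (2 * (gamma j).+1)%:R * c' alpha (gamma + eps j)) w = 0.
    rewrite -dz_hpolyS (_ : hpoly _ _ = fun=> 0); last exact: funext.
    by apply: has_dz_val; exact: has_dz_cst.
  have /eqP := IH _ dF0 _ _ agk.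
  by rewrite mulf_eq0 Num.Theory.pnatr_eq0 muln_eq0 /= => /eqP.
have [be0|/neq0_eps[j [ga beE]]] := eqVneq be 0; last first.
  by rewrite beE; apply: step => //; rewrite -beE.
have [al0|/neq0_eps[j [ga alE]]] := eqVneq al 0.
  by move/eqP: abk; rewrite al0 be0 /mdeg !big1 // => i _; rewrite ffunE.
(* Here [be = 0] and [al <> 0]: in the conjugate polynomial [al] becomes the second index. *)
apply/eqP; rewrite -conjc_eq0; apply/eqP; rewrite alE.
apply: (step (fun al be => (c be al)^*)).
  by move=> w; rewrite -conjc_hpoly F0 conjc0.
by rewrite -alE addnC.
Qed.

Lemma calL_hpolySS k c w : calL (hpoly k.+2 c) w =
  hpoly k (fun alpha gamma => 4 * \sum_(j < n)
    ((gamma j + 2) * (gamma j + 1))%:R * c alpha (gamma + eps j *+ 2)) w.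
Proof.
rewrite /calL; under eq_bigr do rewrite !dz_hpolyS.
rewrite hpoly_sum; apply: eq_fsbigr => -[al ga] _ /=.
congr (_ * _ * _); rewrite mulr_sumr; apply: eq_bigr => j _.
(* The inner [dz j] gives [2 * (gamma j + 2)], read at the index [gamma + eps j], and the outer one
   [2 * (gamma j + 1)]. *)
rewrite mulr2n addrA mulrA -natrM addepsE mulrA -natrM.
by congr (_%:R * _); rewrite !addn1 addn2; ring.
Qed.

End Hpoly.

(** * The coefficient criterion *)

Theorem proposition5p1 (R : realType) (n k : nat) (hn : (1 <= n)%N)
    (a : multiindex n -> multiindex n -> R[i]) :
  (forall w : R2n R n, calL (hpoly k a) w = 0) <->
  (forall alpha gamma : multiindex n, (mdeg alpha + mdeg gamma + 2 = k)%N ->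
     \sum_(j < n) ((gamma j + 2) * (gamma j + 1))%:R *
        a alpha (gamma + eps j *+ 2) = 0).
Proof.
have dz0 (j : 'I_n) (w : R2n R n) : dz j (fun=> 0 : R[i]) w = 0.
  by apply: has_dz_val; exact: has_dz_cst.
(* For [k < 2] the degree constraint has no solution, and two applications of [dz j] give zero. *)
case: k => [|[|k]].
- split=> [_ al ga|_ w]; first by rewrite addn2.
  by apply: big1 => j _; rewrite dz_hpoly0 dz0.
- split=> [_ al ga|_ w]; first by rewrite addn2.
  by apply: big1 => j _; rewrite dz_hpolyS dz_hpoly0.
have -> : (forall w, calL (hpoly k.+2 a) w = 0) <-> (forall w, hpoly k
   (fun alpha gamma => 4 * \sum_(j < n) ((gamma j + 2) * (gamma j + 1))%:R *
      a alpha (gamma + eps j *+ 2)) w = 0).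
  by split=> L0 w; have := L0 w; rewrite calL_hpolySS.
(* The two conditions now differ only by the nonzero factor [4] and the form of the degree
   constraint. *)
rewrite hpoly_eq0P; split=> S0 al ga agk.
  have agk' : (mdeg al + mdeg ga = k)%N by move: agk; rewrite addn2 => -[].
  have /eqP := S0 al ga agk'.
  by rewrite mulf_eq0 Num.Theory.pnatr_eq0 /= => /eqP.
by rewrite S0 ?mulr0 // addn2 agk.
Qed.
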